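(* Let $\mathrm{k}$ be a field, let $S = \mathrm{k}[x_1,\ldots,x_n]$ be the standard graded polynomial ring, and let $I$ be a nonzero proper squarefree monomial ideal of $S$ with $\dim(S/I) = d$. Let $\mu$ be the number of associated primes $P$ of $S/I$ with $\dim(S/P) = d$. Then $$e_0(S/I^s) = \mu \binom{n-d+s-1}{s-1}$$ for all integers $s \ge 1$.
   Context: A squarefree monomial ideal is an ideal generated by squarefree monomials in $x_1,\ldots,x_n$. The dimension of an ideal $I$ means the Krull dimension of $S/I$. Multiplicity: for a nonzero finitely generated graded $S$-module $M$ of Krull dimension $D$, there is a Laurent polynomial $Q_M(t)\in\mathbb{Z}[t,t^{-1}]$ with $Q_M(1)>0$ such that $\sum_{a\in\mathbb{Z}} \dim_{\mathrm{k}}(M_a)\,t^a = Q_M(t)/(1-t)^D$. The multiplicity of $M$ is $e_0(M) = Q_M(1)$. Equivalently, when $D\ge 1$, $e_0(M)/(D-1)!$ is the leading coefficient (of $a^{D-1}$) of the Hilbert polynomial that agrees with $\dim_{\mathrm{k}} M_a$ for $a\gg 0$; when $D=0$, $e_0(M)=\dim_{\mathrm{k}} M$. *)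

(* Defs.v *)
From HB Require Import structures.
From mathcomp Require Import all_boot all_order all_algebra.
From mathcomp Require Import boolp classical_sets cardinality.
From mathcomp Require Import mpoly.

Set Implicit Arguments.
Unset Strict Implicit.
Unset Printing Implicit Defensive.

Import Order.TTheory GRing.Theory Num.Theory.

Local Open Scope classical_set_scope.
Local Open Scope ring_scope.

Section Ideals.
Variable R : comNzRingType.
Implicit Types A I J P : set R.

(* [idealr_closed] includes the properness condition 1 \notin I. *)
Definition is_proper_ideal I : Prop := idealr_closed [pred x in I].

Definition is_prime_ideal P : Prop :=
  is_proper_ideal P /\ prime_idealr_closed [pred x in P].

Definition ideal_gen A : set R :=
  [set x | exists s : seq (R * R),
     (forall p, p \in s -> A p.2) /\ x = \sum_(p <- s) p.1 * p.2].

Definition ideal_mul I J : set R :=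
  ideal_gen [set x | exists a b, [/\ I a, J b & x = a * b]].

Definition ideal_exp I (s : nat) : set R := iter s (ideal_mul I) setT.

(* The annihilator of the class of f in R / I, i.e. the colon ideal (I : f). *)
Definition ann_class I (f : R) : set R := [set g | I (g * f)].

Definition is_assoc_prime I P : Prop :=
  is_prime_ideal P /\ exists f : R, P = ann_class I f.

(* Strict chains p 0 < ... < p m of prime ideals; values beyond m are junk. *)
Definition is_prime_chain (m : nat) (p : nat -> set R) : Prop :=
  (forall i, (i <= m)%N -> is_prime_ideal (p i)) /\
  (forall i, (i < m)%N -> p i `<` p i.+1).

End Ideals.

Definition has_krull_dim (R : comNzRingType) (d : nat) : Prop :=
  (exists p : nat -> set R, is_prime_chain d p) /\
  (forall m (p : nat -> set R), is_prime_chain m p -> (m <= d)%N).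

Section Quotient.
Variables (R : comNzRingType) (I : set R).

Definition proper_idealr (hI : is_proper_ideal I) : idealr R :=
  HB.pack_for (idealr R) (fun x : R => x \in I)
    (isIdealr.Build R (fun x : R => x \in I) hI).

Definition quot_ring (hI : is_proper_ideal I) : comNzRingType :=
  {ideal_quot proper_idealr hI}.

(* The Krull dimension of R / I is d; in particular I is a proper ideal. *)
Definition has_quot_dim (d : nat) : Prop :=
  exists hI : is_proper_ideal I, has_krull_dim (quot_ring hI) d.

End Quotient.

(* The family b induces a basis of the quotient space V / (V :&: W), for
   subspaces V and W of E. *)
Definition is_basis_mod (K : fieldType) (E : lmodType K) (V W : set E)
    (h : nat) (b : 'I_h -> E) : Prop :=
  [/\ forall i, V (b i),
      forall v, V v -> exists c : 'I_h -> K, W (v - \sum_i c i *: b i)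
    & forall c : 'I_h -> K, W (\sum_i c i *: b i) -> forall i, c i = 0].

Definition has_dim_mod (K : fieldType) (E : lmodType K) (V W : set E)
    (h : nat) : Prop :=
  exists b : 'I_h -> E, is_basis_mod V W b.

Section Graded.
Variables (k : fieldType) (n : nat).
Local Notation S := {mpoly k[n]}.

Definition squarefree_mnm (m : 'X_{1..n}) : Prop := forall i, (m i <= 1)%N.

Definition is_squarefree_monomial_ideal (I : set S) : Prop :=
  exists G : set 'X_{1..n},
    (forall m, G m -> squarefree_mnm m) /\
    I = ideal_gen [set f | exists2 m, G m & f = 'X_[m]].

(* For J homogeneous, the degree j part of S / J is S_j / (S_j :&: J). *)
Definition is_hilbert_function (J : set S) (H : nat -> nat) : Prop :=
  forall j, has_dim_mod [set f : S | f \is j.-homog] J (H j).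

(* (1 - t)^D * \sum_a H(a) t^a = Q(t) as formal power series.  Since S / J
   vanishes in negative degrees, the Laurent polynomial Q is a polynomial. *)
Definition is_hilbert_numerator (H : nat -> nat) (D : nat) (Q : {poly int}) :
    Prop :=
  forall a, \sum_(i < a.+1) ((1 - 'X : {poly int}) ^+ D)`_i * (H (a - i)%N)%:Z
            = Q`_a.

(* e_0(S / J) = e, for J a proper homogeneous ideal; D, H, Q and hence e are
   uniquely determined by J. *)
Definition has_multiplicity (J : set S) (e : int) : Prop :=
  exists (D : nat) (H : nat -> nat) (Q : {poly int}),
    [/\ has_quot_dim J D, is_hilbert_function J H,
        is_hilbert_numerator H D Q, 0 < Q.[1] & e = Q.[1]].

End Graded.

(* Main.v *)
(** All ideals in sight are monomial, so S / I^s has a basis of monomials and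
  everything is read off sets of exponent vectors.  Let G be the generating
  monomials of I; a set F of variables is a cover if it meets every g in G,
  i.e. if I lies in the prime P_F generated by F, and every prime above I (or
  above I^s) contains some P_F.  Hence dim S / I = dim S / I^s = n - c with c
  the least size of a cover, and the top-dimensional associated primes are the
  P_F with F a cover of size c.

  That chains of primes above P_F have length at most n - #|F| is proved by
  counting: choosing f_i in p_(i+1) but not in p_i along a chain of length l,
  the monomials of degree < N in each f_i are linearly independent modulo p_0,
  so N ^ l is at most the number, O(N ^ (n - #|F|)), of monomials of degree
  O(N) in the variables outside F.

  Since G is squarefree, m lies in I^s if and only if its truncation v, with
  v_i = min(m_i, s), does.  The monomials outside I^s therefore split into
  cones v * k[x_i : v_i = s], and the Hilbert series of S / I^s is the sum of
  t^|v| / (1 - t)^(number of i with v_i = s).  The multiplicity is the number of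
  cones of dimension n - c.  For such a cone F = {i : v_i < s} is a cover of
  size c, and then v is outside I^s if and only if the sum of v_i over F is
  below s, which leaves 'C(c + s - 1, s - 1) choices for each F. *)

Require Import Defs.
From HB Require Import structures.
From mathcomp Require Import all_boot all_order all_algebra.
From mathcomp Require Import boolp classical_sets cardinality.
From mathcomp Require Import mpoly.
From mathcomp Require Import zify.

Set Implicit Arguments.
Unset Strict Implicit.
Unset Printing Implicit Defensive.

Import Order.TTheory GRing.Theory Num.Theory.

Local Open Scope classical_set_scope.
Local Open Scope card_scope.
Local Open Scope ring_scope.

(** * Prime ideals and chains *)

Section IdealPredicates.
Variable R : comNzRingType.
Implicit Types I J P : set R.

Lemma proper_idealP I :
  is_proper_ideal I <->
  [/\ I 0, ~ I 1 & forall a u v, I u -> I v -> I (a * u + v)].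
Proof.
split=> [[/set_mem I0 /negP nI1 IL]|[I0 nI1 IL]].
  split=> // [I1|a u v Iu Iv]; first by apply: nI1; exact: mem_set.
  by apply/set_mem; apply: IL; exact: mem_set.
split; first by apply/mem_set.
  by apply/negP => /set_mem.
by move=> a u v /set_mem Iu /set_mem Iv; apply/mem_set; apply: IL.
Qed.

Lemma prime_idealP P :
  is_prime_ideal P <->
  is_proper_ideal P /\ forall u v, P (u * v) -> P u \/ P v.
Proof.
split=> [[hP pP]|[hP pP]]; split=> // u v.
  by move=> /mem_set /pP /orP[] /set_mem; [left|right].
by move=> /set_mem /pP[] /mem_set h; apply/orP; [left|right].
Qed.

Lemma prime_proper P : is_prime_ideal P -> is_proper_ideal P.
Proof. by case. Qed.

Section Proper.
Variables (I : set R) (hI : is_proper_ideal I).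

Lemma ideal0 : I 0. Proof. by case/proper_idealP: hI. Qed.

Lemma ideal1 : ~ I 1. Proof. by case/proper_idealP: hI. Qed.

Lemma idealD u v : I u -> I v -> I (u + v).
Proof.
by move=> Iu Iv; case/proper_idealP: hI => _ _ /(_ 1 u v Iu Iv); rewrite mul1r.
Qed.

Lemma idealMl a u : I u -> I (a * u).
Proof.
move=> Iu; case/proper_idealP: hI => I0 _ /(_ a u 0 Iu I0).
by rewrite addr0.
Qed.

Lemma idealN u : I u -> I (- u).
Proof. by rewrite -mulN1r; apply: idealMl. Qed.

Lemma idealB u v : I u -> I v -> I (u - v).
Proof. by move=> Iu Iv; apply: idealD => //; apply: idealN. Qed.

Lemma ideal_sum (T : Type) (r : seq T) (p : pred T) (F : T -> R) :
  (forall i, p i -> I (F i)) -> I (\sum_(i <- r | p i) F i).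
Proof. by move=> h; elim/big_ind: _ => //; [apply: ideal0|apply: idealD]. Qed.

End Proper.

Lemma prime_exp P x m : is_prime_ideal P -> P (x ^+ m) -> P x.
Proof.
move=> pP; elim: m => [|m IHm]; first by case: (prime_proper pP) => _ /negP + _;
  rewrite expr0 => h /mem_set.
by rewrite exprS; case/prime_idealP: pP => _ h /h[].
Qed.

Lemma prime_prod P (T : eqType) (r : seq T) (F : T -> R) :
  is_prime_ideal P -> P (\prod_(i <- r) F i) -> exists2 i, i \in r & P (F i).
Proof.
move=> pP; elim: r => [|x r IHr].
  by rewrite big_nil => /(ideal1 (prime_proper pP)).
rewrite big_cons; case/prime_idealP: (pP) => _ h /h[Px|/IHr[i ri Pi]].
  by exists x; rewrite ?mem_head.
by exists i; rewrite // inE ri orbT.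
Qed.

(* Through a surjection R -> R / J, these are the chains of primes of R / J. *)
Definition chain_above J (m : nat) (p : nat -> set R) : Prop :=
  is_prime_chain m p /\ J `<=` p 0%N.

Lemma prime_chain_le m (p : nat -> set R) i j :
  is_prime_chain m p -> (i <= j)%N -> (j <= m)%N -> p i `<=` p j.
Proof.
move=> [_ hp]; elim: j => [|j IHj]; first by rewrite leqn0 => /eqP -> _ x.
rewrite leq_eqVlt => /predU1P[-> _ x //|lij jm].
apply: (subset_trans (IHj lij (ltnW jm))).
by case: (hp j jm).
Qed.

Lemma prime_chain_tail m (p : nat -> set R) :
  is_prime_chain m.+1 p -> is_prime_chain m (fun i => p i.+1).
Proof. by move=> [h1 h2]; split=> i im; [apply: h1|apply: h2]. Qed.

Lemma prime_chain_cons P m (p : nat -> set R) : is_prime_ideal P ->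
  is_prime_chain m p -> P `<` p 0%N ->
  is_prime_chain m.+1 (fun i => if i is j.+1 then p j else P).
Proof.
by move=> pP [h1 h2] lt; split=> [[|i] // im|[|i] // im]; [apply: h1|apply: h2].
Qed.

End IdealPredicates.

(** * Chains of primes in a quotient ring *)

Section QuotientChains.
Variables (R R' : comNzRingType) (f : {rmorphism R -> R'}) (J : set R).
Hypothesis f_surj : forall y, exists x, f x = y.
Hypothesis f_ker : forall x, f x = 0 <-> J x.

Lemma prime_preimage (P : set R') :
  is_prime_ideal P -> is_prime_ideal (f @^-1` P).
Proof.
move=> /prime_idealP[/proper_idealP[P0 nP1 PL] pP].
apply/prime_idealP; split; last by move=> u v; rewrite /preimage /= rmorphM => /pP.
apply/proper_idealP; split; rewrite /preimage /= ?rmorph0 ?rmorph1 // => a u v Pu Pv.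
by rewrite rmorphD rmorphM; apply: PL.
Qed.

(** Elements with the same image differ by an element of [J], hence of [P], so membership in [P] can
    be tested on the image. *)
Lemma image_mem (P : set R) x :
  is_proper_ideal P -> J `<=` P -> (f @` P) (f x) <-> P x.
Proof.
move=> hP JP; split=> [[y Py fxy]|Px]; last by exists x.
rewrite -(subrK y x) addrC; apply: (idealD hP) => //.
by apply: JP; apply/f_ker; rewrite rmorphB fxy subrr.
Qed.

Lemma prime_image (P : set R) :
  is_prime_ideal P -> J `<=` P -> is_prime_ideal (f @` P).
Proof.
move=> hP JP; have pP := prime_proper hP.
have E x := image_mem x pP JP.
apply/prime_idealP; split; last first.
  move=> u v; have [x <-] := f_surj u; have [y <-] := f_surj v.
  by rewrite -rmorphM => /E; case/prime_idealP: hP => _ h /h[] /E; [left|right].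
apply/proper_idealP; split.
- by rewrite -(rmorph0 f); apply/E; apply: (ideal0 pP).
- by rewrite -(rmorph1 f) => /E /(ideal1 pP).
move=> a u v; have [w <-] := f_surj a; have [x <-] := f_surj u.
have [y <-] := f_surj v => /E Px /E Py; rewrite -rmorphM -rmorphD; apply/E.
by apply: (idealD pP) => //; apply: (idealMl pP).
Qed.

Lemma prime_chain_preimage m (p : nat -> set R') :
  is_prime_chain m p -> chain_above J m (fun i => f @^-1` (p i)).
Proof.
move=> [h1 h2]; split; first split.
- by move=> i im; apply: prime_preimage; apply: h1.
- move=> i /h2 [le nle]; split=> [x /le//|le']; apply: nle => y.
  by have [x <-] := f_surj y; apply: le'.
move=> x /f_ker fx0; rewrite /preimage /= fx0.
by apply: ideal0; apply: prime_proper; apply: h1.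
Qed.

Lemma prime_chain_image m (p : nat -> set R) :
  chain_above J m p -> is_prime_chain m (fun i => f @` (p i)).
Proof.
move=> [hp J0]; have JP i : (i <= m)%N -> J `<=` p i.
  by move=> im; apply: (subset_trans J0); apply: (prime_chain_le hp).
case: (hp) => h1 h2; split=> i im.
  by apply: prime_image; [exact: h1|exact: JP].
have im' := ltnW im; have [le nle] := h2 i im.
split=> [y [x px <-]|le']; first by exists x => //; apply: le.
apply: nle => x px; apply/(image_mem x (prime_proper (h1 i im')) (JP i im')).
by apply: le'; exists x.
Qed.

Lemma krull_dim_chain_above d :
  has_krull_dim R' d <->
  (exists p, chain_above J d p) /\
  (forall m p, chain_above J m p -> (m <= d)%N).
Proof.
split=> [[[p hp] ub]|[[p hp] ub]]; split.
- by eexists; apply: prime_chain_preimage hp.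
- by move=> m q /prime_chain_image /ub.
- by eexists; apply: prime_chain_image hp.
- by move=> m q /prime_chain_preimage /ub.
Qed.

End QuotientChains.

(** Moves dimension from the quotient to chains of primes in [R] itself, the form used from here
    on. *)
Lemma quot_dimP (R : comNzRingType) (J : set R) d :
  has_quot_dim J d <->
  [/\ is_proper_ideal J, exists p, chain_above J d p
    & forall m p, chain_above J m p -> (m <= d)%N].
Proof.
have surj (hJ : is_proper_ideal J) (y : quot_ring hJ) :
    exists x : R, \pi_(quot_ring hJ)%qT x = y.
  by exists (repr y); rewrite reprK.
have ker (hJ : is_proper_ideal J) (x : R) :
    \pi_(quot_ring hJ)%qT x = 0 <-> J x.
  split=> [/eqP|Jx].
    rewrite -[0](rmorph0 \pi_(quot_ring hJ)%qT) -Quotient.idealrBE subr0.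
    by move=> /set_mem.
  apply/eqP; rewrite -[0](rmorph0 \pi_(quot_ring hJ)%qT) -Quotient.idealrBE subr0.
  exact: mem_set.
split=> [[hJ /(krull_dim_chain_above (surj hJ) (ker hJ))[h1 h2]]|[hJ h1 h2]].
  by split.
by exists hJ; apply/(krull_dim_chain_above (surj hJ) (ker hJ)).
Qed.
(** * Monomial ideals *)

Section MonomialIdeals.
Variables (k : fieldType) (n : nat).
Local Notation S := {mpoly k[n]}.
Implicit Types (B C : 'X_{1..n} -> Prop) (F : {set 'I_n}).

(** A monomial ideal is represented by its set of exponents rather than by generators; it absorbs
    multiplication once [mnm_up B] holds. *)
Definition monomial_ideal B : set S := [set f | forall m, m \in msupp f -> B m].

Definition mnm_up B : Prop := forall m m', (m <= m')%MM -> B m -> B m'.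

Lemma monomial_idealX B m : monomial_ideal B 'X_[m] <-> B m.
Proof.
split=> [|Bm m']; first by apply; rewrite msuppX mem_head.
by rewrite msuppX inE => /eqP ->.
Qed.

Lemma monomial_idealM B f g :
  mnm_up B -> monomial_ideal B g -> monomial_ideal B (f * g).
Proof.
move=> upB Bg m /msuppM_le /allpairsP[[m1 m2] /= [_ m2g ->]].
by apply: upB (Bg _ m2g); apply: lem_addl.
Qed.

Lemma monomial_ideal0 B : monomial_ideal B 0.
Proof. by move=> m; rewrite msupp0. Qed.

Lemma monomial_idealD B f g :
  monomial_ideal B f -> monomial_ideal B g -> monomial_ideal B (f + g).
Proof. by move=> Bf Bg m /msuppD_le; rewrite mem_cat => /orP[/Bf|/Bg]. Qed.

Lemma monomial_ideal_sum B (T : eqType) (r : seq T) (F : T -> S) :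
  (forall i, i \in r -> monomial_ideal B (F i)) ->
  monomial_ideal B (\sum_(i <- r) F i).
Proof.
move=> h; rewrite big_seq; elim/big_ind: _ => //.
  exact: monomial_ideal0.
exact: monomial_idealD.
Qed.

Lemma monomial_ideal_proper B :
  mnm_up B -> ~ B 0%MM -> is_proper_ideal (monomial_ideal B).
Proof.
move=> upB nB0; apply/proper_idealP; split.
- exact: monomial_ideal0.
- by move=> /(_ 0%MM); rewrite msupp1 mem_head => /(_ isT).
- by move=> a u v Bu Bv; apply: monomial_idealD => //; apply: monomial_idealM.
Qed.

Lemma monomial_idealS B C :
  (forall m, B m -> C m) -> monomial_ideal B `<=` monomial_ideal C.
Proof. by move=> BC f Bf m /Bf /BC. Qed.

Lemma ideal_gen_monomial (A : set S) C : mnm_up C ->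
  A `<=` monomial_ideal C ->
  (forall m, C m -> exists2 m', (m' <= m)%MM & A 'X_[m']) ->
  ideal_gen A = monomial_ideal C.
Proof.
move=> upC AC CA; apply/seteqP; split=> [_ [s [sA ->]]|f Cf].
  apply: monomial_ideal_sum => p /sA /AC; exact: monomial_idealM.
(* [g] picks for each [m] in [C] a monomial of [A] dividing it; its value [0%MM] outside [C] is a
   default. *)
have [g gP] : {g : 'X_{1..n} -> 'X_{1..n} &
    forall m, C m -> (g m <= m)%MM /\ A 'X_[g m]}.
  apply: (@choice _ _ (fun m m' => C m -> (m' <= m)%MM /\ A 'X_[m'])) => m.
  have [/CA[m' h1 h2]|nC] := pselect (C m); first by exists m'.
  by exists 0%MM.
exists [seq (f@_m *: 'X_[m - g m], 'X_[g m]) | m <- msupp f]; split.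
  by move=> p /mapP[m /Cf /gP[_ h] ->].
rewrite big_map {1}(mpolyE f) !big_seq; apply: eq_bigr => m /Cf /gP[le _] /=.
by rewrite -scalerAl -mpolyXD submK.
Qed.

Definition mnm_above (G : set 'X_{1..n}) : 'X_{1..n} -> Prop :=
  fun m => exists2 g, G g & (g <= m)%MM.

Lemma mnm_above_up G : mnm_up (mnm_above G).
Proof. by move=> m m' le [g Gg gm]; exists g => //; apply: lepm_trans le. Qed.

Lemma ideal_gen_above G :
  ideal_gen [set f : S | exists2 m, G m & f = 'X_[m]] =
  monomial_ideal (mnm_above G).
Proof.
apply: ideal_gen_monomial; first exact: mnm_above_up.
  by move=> _ [m Gm ->]; apply/monomial_idealX; exists m => //; apply: lepm_refl.
by move=> m [g Gg gm]; exists g => //; exists g.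
Qed.

Definition mnm_mul B C : 'X_{1..n} -> Prop :=
  fun m => exists b c, [/\ B b, C c & m = (b + c)%MM].

Definition mnm_exp B s : 'X_{1..n} -> Prop :=
  iter s (mnm_mul B) (fun _ => True).

Lemma mnm_mul_up B C : mnm_up C -> mnm_up (mnm_mul B C).
Proof.
(* The excess of [m'] over [m] is absorbed by the factor in [C], which is closed upward. *)
move=> upC m m' le [b [c [Bb Cc mE]]]; exists b, (m' - b)%MM; split => //.
  apply: upC Cc; apply/mnm_lepP => i; rewrite mnmBE.
  by move/mnm_lepP/(_ i): le; rewrite mE mnmDE; lia.
rewrite addmC submK //; apply: lepm_trans le; rewrite mE; exact: lem_addr.
Qed.

Lemma mnm_exp_up B s : mnm_up (mnm_exp B s).
Proof. by elim: s => //= s IHs; apply: mnm_mul_up. Qed.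

Lemma ideal_mul_monomial B C : mnm_up C ->
  ideal_mul (monomial_ideal B) (monomial_ideal C) =
  monomial_ideal (mnm_mul B C).
Proof.
move=> upC; apply: ideal_gen_monomial; first exact: mnm_mul_up.
  move=> _ [a [b [Ba Cb ->]]] m /msuppM_le /allpairsP[[m1 m2] /= [m1a m2b ->]].
  by exists m1, m2; split; [apply: Ba|apply: Cb|].
move=> m [b [c [Bb Cc ->]]]; exists (b + c)%MM; first exact: lepm_refl.
by exists 'X_[b], 'X_[c]; split; rewrite ?mpolyXD //; apply/monomial_idealX.
Qed.

Lemma ideal_exp_monomial B s :
  ideal_exp (monomial_ideal B) s = monomial_ideal (mnm_exp B s).
Proof.
elim: s => [|s IHs]; first by apply/seteqP; split.
rewrite /ideal_exp iterS -/(ideal_exp _ s) IHs ideal_mul_monomial //.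
exact: mnm_exp_up.
Qed.

Definition meets F (m : 'X_{1..n}) : bool := [exists i in F, m i != 0%N].

Lemma meetsP F (m : 'X_{1..n}) :
  reflect (exists2 i, i \in F & m i != 0%N) (meets F m).
Proof. exact: exists_inP. Qed.

Lemma meets_up F : mnm_up (meets F).
Proof.
move=> m m' /mnm_lepP le /meetsP[i iF mi]; apply/meetsP; exists i => //.
by rewrite -lt0n (leq_trans _ (le i)) // lt0n.
Qed.

Lemma meets1 F i : meets F U_(i)%MM = (i \in F).
Proof.
apply/meetsP/idP => [[j jF]|iF]; last by exists i; rewrite // mnm1E eqxx.
by rewrite mnm1E; case: (i =P j) => [->|].
Qed.

Definition var_ideal F : set S := monomial_ideal (meets F).

(** The substitution of 0 for the variables in [F]. Its kernel is [var_ideal F], which is prime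
    because the target is a domain. *)
Definition kill_vars F : S -> S :=
  mmap (@mpolyC n k) (fun i => if i \in F then 0 else 'X_i).

HB.instance Definition _ F := GRing.RMorphism.on (kill_vars F).

Lemma mcoeff_kill_vars F f m :
  (kill_vars F f)@_m = if meets F m then 0 else f@_m.
Proof.
have kX m' : mmap1 (fun i => if i \in F then 0 else 'X_i) m' =
    if meets F m' then 0 else 'X_[m'] :> S.
  rewrite /mmap1; case: (boolP (meets F m')) => [/meetsP[i iF mi]|nmeet].
    by rewrite (bigD1 i) //= iF expr0n (negPf mi) mul0r.
  rewrite mpolyXE_id; apply: eq_bigr => i _; case: ifP => // iF.
  have -> : m' i = 0%N.
    by apply/eqP; apply: contraNT nmeet => mi; apply/meetsP; exists i.
  by rewrite !expr0.
rewrite /kill_vars /mmap raddf_sum /= [in RHS](mpolyE f) raddf_sum /=.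
case: ifP => meet; [apply: big1|apply: eq_bigr] => m' _; rewrite kX mcoeffCM.
  case: ifP; rewrite ?mcoeff0 ?mulr0 // mcoeffX.
  by case: eqP => [->|_]; rewrite ?meet ?mulr0.
rewrite mcoeffZ; case: ifP => // meet'; rewrite mcoeff0 mcoeffX.
by case: eqP => // E; rewrite -E meet' in meet.
Qed.

Lemma kill_vars_eq0 F f : kill_vars F f = 0 <-> var_ideal F f.
Proof.
split=> [k0 m|Ff].
  rewrite mcoeff_msupp => fm; apply: contraNT fm => /negPf nm.
  by move/mpolyP/(_ m): k0; rewrite mcoeff_kill_vars nm mcoeff0 => ->.
apply/mpolyP => m; rewrite mcoeff_kill_vars mcoeff0; case: ifP => // /negbT nm.
by apply: memN_msupp_eq0; apply: contra nm; apply: Ff.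
Qed.

Lemma var_ideal_prime F : is_prime_ideal (var_ideal F).
Proof.
apply/prime_idealP; split.
  apply: monomial_ideal_proper; first exact: meets_up.
  by move=> /meetsP[i _]; rewrite mnm0E.
move=> u v /kill_vars_eq0; rewrite rmorphM => /eqP.
by rewrite mulf_eq0 => /orP[] /eqP /kill_vars_eq0; [left|right].
Qed.

Lemma var_idealX F i : var_ideal F 'X_i <-> i \in F.
Proof. by rewrite -meets1; apply: monomial_idealX. Qed.

Lemma var_ideal_min F (P : set S) : is_proper_ideal P ->
  (forall i, i \in F -> P 'X_i) -> var_ideal F `<=` P.
Proof.
move=> hP FP f Ff; rewrite (mpolyE f) big_seq; apply: ideal_sum => // m /Ff.
move=> /meetsP[i iF mi]; rewrite -mul_mpolyC; apply: idealMl => //.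
rewrite -(@submK _ U_(i) m) ?lep1mP // mpolyXD; apply: idealMl => //.
exact: FP.
Qed.

Lemma var_ideal_subset F F' : var_ideal F `<=` var_ideal F' <-> F \subset F'.
Proof.
split=> [le|/fintype.subsetP le].
  by apply/fintype.subsetP => i /var_idealX /le /var_idealX.
apply: var_ideal_min => [|i /le /var_idealX //].
exact: prime_proper (var_ideal_prime _).
Qed.

(** The variables outside [F] are adjoined one at a time; each step is strict because the new
    variable is neither in [F] nor among those adjoined before. *)
Lemma var_ideal_chain F :
  exists p, is_prime_chain (n - #|F|) p /\ p 0%N = var_ideal F.
Proof.
pose s := enum (~: F).
have size_s : size s = (n - #|F|)%N.
  by rewrite -cardE cardsCs finset.setCK card_ord.
exists (fun i => var_ideal (F :|: [set x in take i s])); split; last first.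
  by congr var_ideal; apply/finset.setP => x; rewrite take0 !inE orbF.
split=> [i _|i im]; first exact: var_ideal_prime.
have x0 : 'I_n by case: (s) size_s im => [/= <-|x ? _ _] //; exact: x.
split.
  apply/var_ideal_subset; apply: finset.setUS.
  apply/fintype.subsetP => x; rewrite !inE.
  rewrite (take_nth x0) ?size_s // mem_rcons inE => ->; exact: orbT.
move=> /var_ideal_subset /fintype.subsetP /(_ (nth x0 s i)).
have ns : nth x0 s i \in s by apply: mem_nth; rewrite size_s.
rewrite !inE (take_nth x0) ?size_s // mem_rcons mem_head orbT => /(_ isT).
move: (ns); rewrite mem_enum inE => /negPf -> /=.
have ni : index (nth x0 s i) s = i by rewrite index_uniq ?size_s ?enum_uniq.
by rewrite in_take_leq ?ni ?ltnn // size_s ltnW.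
Qed.

End MonomialIdeals.
(** * Krull dimension *)

Section ChainLength.
Variables (k : fieldType) (n : nat).
Local Notation S := {mpoly k[n]}.
Implicit Types (P Q : set S) (F : {set 'I_n}).

Definition free_mod Q (T : finType) (e : T -> S) : Prop :=
  forall c : T -> k, Q (\sum_t c t *: e t) -> forall t, c t = 0.

(** Modulo [Q], where [f] vanishes, a relation reduces to its [f ^+ 0] part, whose coefficients are
    therefore 0. The rest is a multiple of [f], which cancels modulo the prime [P], and induction on
    [N] applies. *)
Lemma free_mod_powers P Q f (T : finType) (e : T -> S) N :
    is_prime_ideal P -> is_proper_ideal Q -> P `<=` Q -> Q f -> ~ P f ->
    free_mod Q e ->
  free_mod P (fun u : 'I_N * T => f ^+ u.1 * e u.2).
Proof.
move=> pP hQ PQ Qf nPf eQ.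
(* Indexing the coefficients by [nat] instead of ['I_N] lets the induction shift the exponent of
   [f]. *)
suff main (c : nat -> T -> k) :
    P (\sum_(a < N) f ^+ a * \sum_t c a t *: e t) ->
    forall a t, (a < N)%N -> c a t = 0.
  move=> c Pc [a t]; pose c' a t := if insub a is Some a' then c (a', t) else 0.
  rewrite (_ : c (a, t) = c' a t); last by rewrite /c' valK.
  apply: main => //; rewrite (eq_bigr (fun b : 'I_N =>
      \sum_t' c (b, t') *: (f ^+ b * e t'))); last first.
    move=> b _; rewrite mulr_sumr; apply: eq_bigr => t' _.
    by rewrite -scalerAr /c' valK.
  by rewrite pair_bigA (eq_bigr (fun u => c u *: (f ^+ u.1 * e u.2))) // => -[].
elim: N c => [|N IHN] c //; rewrite big_ord_recl expr0 mul1r.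
set E := \sum_t _; set rest := \sum_(a < N) _ => Psum.
have restE : rest = f * \sum_(a < N) f ^+ a * \sum_t c a.+1 t *: e t.
  by rewrite mulr_sumr; apply: eq_bigr => a _; rewrite mulrA -exprS.
have QE : Q E.
  rewrite -(addrK rest E); apply: (idealB hQ); first exact: PQ.
  by rewrite restE mulrC; apply: (idealMl hQ).
have c0 := eQ _ QE.
have E0 : E = 0 by rewrite /E big1 // => t _; rewrite c0 scale0r.
move: Psum; rewrite E0 add0r restE => Psum [|a] t aN; first exact: c0.
apply: (IHN (fun a => c a.+1)) => //.
by case/prime_idealP: pP => _ /(_ _ _ Psum) [].
Qed.

Lemma mdeg_expM (f g : S) a m K :
  (forall m', m' \in msupp g -> (mdeg m' <= K)%N) ->
  m \in msupp (f ^+ a * g) -> (mdeg m <= msize f * a + K)%N.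
Proof.
move=> gK; elim: a m => [|a IHa] m; first by rewrite expr0 mul1r muln0 => /gK.
rewrite exprS -mulrA => /msuppM_le.
move=> /allpairsP[[m1 m2] /= [/msize_mdeg_lt h1 h2 ->]].
by rewrite mdegD mulnS -addnA leq_add ?IHa // ltnW.
Qed.

Lemma chain_free_family l (p : nat -> set S) : is_prime_chain l p ->
  exists L, forall N, exists (T : finType) (e : T -> S),
    [/\ #|T| = (N ^ l)%N,
        forall t m, m \in msupp (e t) -> (mdeg m <= L * N)%N
      & free_mod (p 0%N) e].
Proof.
elim: l p => [|l IHl] p hp.
  exists 0%N => N; exists unit, (fun=> 1); split=> [|t m|c].
  - by rewrite card_unit.
  - by rewrite msupp1 inE => /eqP ->; rewrite mdeg0.
  have hp0 : is_proper_ideal (p 0%N) by apply: prime_proper; apply: hp.1.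
  rewrite (bigD1 tt) //= big1 ?addr0; last by case.
  move=> pc []; apply: contrapT => /eqP c0; apply: (ideal1 hp0).
  rewrite -[1](scale1r 1) -(mulVf c0) -scalerA -mul_mpolyC.
  exact: idealMl.
have [L' hL'] := IHl _ (prime_chain_tail hp).
have [sub01 /existsNP[f /not_implyP[p1f np0f]]] := hp.2 0%N (ltn0Sn l).
(* Powers of [f] with exponent below [N] add at most [msize f * N] to the degree, so the slope grows
   by [msize f]. *)
exists (msize f + L')%N => N; have [T [e [cardT degT freeT]]] := hL' N.
exists ('I_N * T)%type, (fun u : 'I_N * T => f ^+ u.1 * e u.2); split.
- by rewrite card_prod card_ord cardT expnS.
- move=> [a t] m /= /(mdeg_expM (degT t)) /leq_trans; apply.
  by rewrite mulnDl leq_add2r leq_mul2l ltnW ?orbT.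
apply: (free_mod_powers _ _ sub01) => //; first exact: hp.1.
by apply: prime_proper; apply: hp.1.
Qed.

(* More than K.+1 ^ (n - #|F|) polynomials of degree at most K have a nontrivial
   combination with no monomial outside var_ideal F. *)
Lemma free_mod_card F Q (T : finType) (e : T -> S) K :
    (var_ideal F : set S) `<=` Q ->
    (forall t m, m \in msupp (e t) -> (mdeg m <= K)%N) ->
  free_mod Q e -> (#|T| <= K.+1 ^ (n - #|F|))%N.
Proof.
(* [X] is the box of exponent vectors vanishing on [F] with entries at most [K]; it contains every
   monomial of degree at most [K] that misses [F], and is easy to count. *)
move=> FQ eK eQ; pose X := pffun_on (@ord0 K) (~: F) (@predT 'I_K.+1).
have -> : (K.+1 ^ (n - #|F|) = #|X|)%N.
  by rewrite card_pffun_on card_ord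
    -[X in (X - _)%N](card_ord n) -(cardsC F) addKn.
pose mnm_of (j : 'I_#|X|) := [multinom (enum_val j i : nat) | i < n].
rewrite leqNgt; apply/negP => ltXT.
pose A : 'M[k]_(#|T|, #|X|) := \matrix_(i, j) (e (enum_val i))@_(mnm_of j).
have /rowV0Pn[v /sub_kermxP vA v0] : kermx A != 0.
  rewrite -mxrank_eq0 mxrank_ker subn_eq0 -ltnNge.
  exact: leq_ltn_trans (rank_leq_col A) ltXT.
suff c0 : forall t, v 0 (enum_rank t) = 0.
  case/eqP: v0; apply/rowP => i; rewrite mxE -[i]enum_valK; exact: c0.
apply: eQ; apply: FQ => m; apply: contraLR => nm.
rewrite mcoeff_msupp negbK raddf_sum /=.
have [mK|Km] := leqP (mdeg m) K; last first.
  apply/eqP; apply: big1 => t _.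
  rewrite mcoeffZ (@memN_msupp_eq0 _ _ (e t)) ?mulr0 //.
  by apply: contraL Km => /eK; rewrite leqNgt.
have mi i : (m i < K.+1)%N.
  by rewrite ltnS (leq_trans _ mK) // mdegE (bigD1 i) //= leq_addr.
pose g : {ffun 'I_n -> 'I_K.+1} := [ffun i => Ordinal (mi i)].
have gX : g \in X.
  apply/pffun_onP; split=> [|x _ //]; apply/supportP => i.
  rewrite inE negbK => iF; apply/val_inj; rewrite ffunE /=.
  by apply/eqP; apply: contraNT nm => h; apply/meetsP; exists i.
move/rowP/(_ (enum_rank_in gX g)): vA; rewrite mxE mxE => vA.
apply/eqP; rewrite -[RHS]vA (reindex (@enum_val T predT)) /=; last first.
  by exists enum_rank => i _; [apply: enum_valK|apply: enum_rankK].
apply: eq_bigr => i _; rewrite mcoeffZ enum_valK mxE; congr (_ * _@_ _).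
by apply/mnmP => j; rewrite mnmE enum_rankK_in // ffunE.
Qed.

Lemma expn_dominates l r L :
  (forall N, N ^ l <= (L * N).+1 ^ r)%N -> (l <= r)%N.
Proof.
move=> h; rewrite leqNgt; apply/negP => lrl.
(* Chosen above [L.+1 ^ r], to contradict [N ^ r.+1 <= (L * N).+1 ^ r <= L.+1 ^ r * N ^ r]. *)
pose N := (L.+1 ^ r).+1.
have : (N ^ r.+1 <= L.+1 ^ r * N ^ r)%N.
  apply: leq_trans (leq_trans (h N) _); first exact: leq_pexp2l.
  rewrite -expnMn; case: (r) => [|r']; first by rewrite !expn0.
  by rewrite leq_exp2r // mulSn -add1n leq_add2r.
by rewrite expnS leq_pmul2r ?expn_gt0 // ltnn.
Qed.

Lemma chain_above_var_ideal F m p :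
  chain_above (var_ideal F : set S) m p -> (m <= n - #|F|)%N.
Proof.
move=> [/chain_free_family[L hL] Fp]; apply: (@expn_dominates _ _ L) => N.
by have [T [e [<- eK efree]]] := hL N; apply: free_mod_card eK efree.
Qed.

End ChainLength.

(** * Dimension by comparison with variable ideals *)

Section QuotientDimension.
Variables (k : fieldType) (n : nat).
Local Notation S := {mpoly k[n]}.
Implicit Types (J P : set S) (F : {set 'I_n}) (G : set 'X_{1..n}).

Lemma quot_dim_unique (R : comNzRingType) (J : set R) d d' :
  has_quot_dim J d -> has_quot_dim J d' -> d = d'.
Proof.
move=> /quot_dimP[_ [p hp] ub] /quot_dimP[_ [p' hp'] ub'].
by apply/eqP; rewrite eqn_leq (ub _ _ hp') (ub' _ _ hp).
Qed.

(** A chain starting at [var_ideal F] gives the lower bound. For the upper bound, the bottom prime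
    of any chain above [J] contains some [var_ideal F'], which limits the length. *)
Lemma quot_dim_var_cover J F :
  is_proper_ideal J -> J `<=` var_ideal F ->
  (forall P, is_prime_ideal P -> J `<=` P ->
    exists2 F', var_ideal F' `<=` P & (#|F| <= #|F'|)%N) ->
  has_quot_dim J (n - #|F|).
Proof.
move=> hJ JF Jcover; apply/quot_dimP; split=> // [|m p [hp J0]].
  by have [p [hp p0]] := var_ideal_chain k F; exists p; split; rewrite ?p0.
have [F' F'0 FF'] := Jcover _ (hp.1 0%N (leq0n m)) J0.
exact: leq_trans (chain_above_var_ideal (conj hp F'0)) (leq_sub2l _ FF').
Qed.

Lemma var_ideal_dim F : has_quot_dim (var_ideal F : set S) (n - #|F|).
Proof.
apply: quot_dim_var_cover => //.
  exact: prime_proper (var_ideal_prime _ _).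
by move=> P _ FP; exists F.
Qed.

(** If the inclusion were strict, [var_ideal F] put below a longest chain above [P] would give a
    chain of length [(n - #|F|).+1], one too long. *)
Lemma prime_dim_var_ideal P F :
  is_prime_ideal P -> var_ideal F `<=` P -> has_quot_dim P (n - #|F|) ->
  P = var_ideal F.
Proof.
move=> hP FP /quot_dimP[_ [p [hp P0]] _]; apply/seteqP; split=> //.
apply: contrapT => nPF.
have lt : var_ideal F `<` p 0%N.
  by split; [apply: subset_trans P0|move=> /(subset_trans P0)].
have hp' := prime_chain_cons (var_ideal_prime k F) hp lt.
have := chain_above_var_ideal (conj hp' (@subset_refl _ _)).
by rewrite ltnn.
Qed.

Definition prime_vars P : {set 'I_n} := [set i | `[< P 'X_i >]]%SET.

Lemma prime_varsP P : is_proper_ideal P -> var_ideal (prime_vars P) `<=` P.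
Proof. by move=> hP; apply: var_ideal_min => // i; rewrite inE => /asboolP. Qed.

Lemma prime_vars_meets P m :
  is_prime_ideal P -> P 'X_[m] -> meets (prime_vars P) m.
Proof.
move=> hP; rewrite mpolyXE_id => /(prime_prod hP)[i _ Pi].
apply/meetsP; exists i; first by rewrite inE; apply/asboolP; apply: prime_exp Pi.
apply: contraPneq Pi => ->; rewrite expr0; exact: ideal1 (prime_proper hP).
Qed.

End QuotientDimension.

(** * Covers *)

Section Covers.
Variables (n : nat) (G : set 'X_{1..n}).
Implicit Types (F : {set 'I_n}).
Hypothesis G_squarefree : forall g, G g -> squarefree_mnm g.

Definition is_cover F : Prop := forall g, G g -> meets F g.

Definition is_min_cover F : Prop :=
  is_cover F /\ forall F', is_cover F' -> (#|F| <= #|F'|)%N.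

Lemma min_cover_exists : ~ G 0%MM -> exists F, is_min_cover F.
Proof.
move=> nG0; have coverT : is_cover (finset.setT : {set 'I_n}).
  move=> g Gg; apply: contraPT Gg => nm; rewrite (_ : g = 0%MM) //.
  apply/mnmP => i; rewrite mnm0E; apply/eqP; apply: contraNT nm => gi.
  by apply/meetsP; exists i.
case: (@arg_minnP _ finset.setT (fun F => `[< is_cover F >])
  (fun F => #|F|)) => //.
  exact/asboolP.
move=> F /asboolP cF minF; exists F; split=> // F' cF'; apply: minF.
exact/asboolP.
Qed.

(** By minimality [F :\ i] is not a cover, and a generator that it misses can meet [F] only at
    [i]. *)
Lemma min_cover_private F i : is_min_cover F -> i \in F ->
  exists2 g, G g & forall j, j \in F -> j != i -> g j = 0%N.
Proof.
move=> [cF minF] iF; have /existsNP[g /not_implyP[Gg nm]] : ~ is_cover (F :\ i).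
  by move=> /minF; rewrite [#|F|](cardsD1 i) iF ltnn.
exists g => // j jF ji; apply: contra_not_eq nm => gj; apply/meetsP.
by exists j => //; rewrite in_setD1 ji.
Qed.

(** A squarefree generator adds at most 1 to each entry, so it adds to the truncation of [c] at [s]
    without exceeding the truncation of [b + c] at [s.+1]. *)
Lemma mnm_exp_min s m :
  mnm_exp (mnm_above G) s m ->
  mnm_exp (mnm_above G) s [multinom minn (m i) s | i < n].
Proof.
elim: s m => //= s IHs m [b [c [[g Gg gb] /IHs hc ->]]].
apply: (mnm_mul_up (@mnm_exp_up _ _ s)); last first.
  exists g, [multinom minn (c i) s | i < n]; split=> //; exists g => //.
  exact: lepm_refl.
apply/mnm_lepP => i; rewrite !mnmE.
by have := G_squarefree Gg i; move/mnm_lepP/(_ i): gb; lia.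
Qed.

Lemma mnm_exp_muln s g : G g -> mnm_exp (mnm_above G) s (g *+ s)%MM.
Proof.
move=> Gg; elim: s => //= s IHs; exists g, (g *+ s)%MM; split=> //.
  by exists g => //; apply: lepm_refl.
by rewrite mulmS.
Qed.

(** Each of the [s] generators whose product divides [m] meets [F], hence contributes at least 1 to
    the degree in [F]. *)
Lemma cover_exp_degree F s m : is_cover F -> mnm_exp (mnm_above G) s m ->
  (s <= \sum_(i in F) m i)%N.
Proof.
move=> cF; elim: s m => //= s IHs m [b [c [[g + gb] /IHs hc ->]]].
move=> /cF /meetsP[i iF gi].
under eq_bigr do rewrite mnmDE.
rewrite big_split -add1n leq_add //= (bigD1 i) //=.
rewrite (leq_trans _ (leq_addr _ _)) //.
by rewrite (leq_trans _ (mnm_lepP gb i)) // lt0n.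
Qed.

(* Peel off generators meeting F in a single variable, one for each unit of
   degree in F. *)
Lemma min_cover_exp F s (m : 'X_{1..n}) : is_min_cover F ->
  (forall i, i \notin F -> s <= m i)%N -> (s <= \sum_(i in F) m i)%N ->
  mnm_exp (mnm_above G) s m.
Proof.
move=> mF; elim: s m => //= s IHs m offF degF.
have [i iF mi] : exists2 i, i \in F & (0 < m i)%N.
  apply: contrapT => h; suff E : (\sum_(i in F) m i = 0)%N.
    by rewrite E in degF.
  apply: big1 => i iF; apply/eqP; rewrite -leqn0 leqNgt; apply/negP => mi.
  by apply: h; exists i.
have [g Gg gF] := min_cover_private mF iF.
have gi := G_squarefree Gg i.
have gm : (g <= m)%MM.
  apply/mnm_lepP => j; have := G_squarefree Gg j.
  have [jF|/offF] := boolP (j \in F); last by lia.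
  have [->|ji] := eqVneq j i; first by lia.
  by rewrite gF.
exists g, (m - g)%MM; split.
- by exists g => //; apply: lepm_refl.
- apply: IHs => [j /offF|].
    by rewrite mnmBE; have := G_squarefree Gg j; lia.
  move: degF; rewrite !(bigD1 i iF) /= mnmBE.
  rewrite [X in _ -> (_ <= _ + X)%N](eq_bigr m); first by lia.
  by move=> j /andP[jF ji]; rewrite mnmBE gF ?subn0.
by rewrite addmC submK.
Qed.

End Covers.

(** * Dimension of the powers and top-dimensional associated primes *)

Section SquarefreeIdeal.
Variables (k : fieldType) (n : nat) (G : set 'X_{1..n}) (F0 : {set 'I_n}).
Local Notation S := {mpoly k[n]}.
Local Notation I := (monomial_ideal (mnm_above G) : set S).
Implicit Types (F : {set 'I_n}) (P : set S).
Hypothesis G_squarefree : forall g, G g -> squarefree_mnm g.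
Hypothesis F0_min : is_min_cover G F0.

(** A prime above the power contains the [s]-th power of each generator, hence the generator, hence
    one of its variables: its variables form a cover. *)
Lemma exp_dim s : (0 < s)%N -> has_quot_dim (ideal_exp I s) (n - #|F0|).
Proof.
move=> s0; rewrite ideal_exp_monomial.
have sub : monomial_ideal (mnm_exp (mnm_above G) s) `<=` (var_ideal F0 : set S).
  apply: monomial_idealS => m /(cover_exp_degree F0_min.1) h; apply/meetsP.
  apply: contrapT => nm; move: h; rewrite leqNgt big1 ?s0 // => i iF.
  by apply: contrapT => /eqP mi; apply: nm; exists i.
apply: quot_dim_var_cover => // [|P hP sP].
  apply: monomial_ideal_proper; first exact: mnm_exp_up.
  move=> /(monomial_idealX k) /sub /monomial_idealX /meetsP[i _].
  by rewrite mnm0E.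
exists (prime_vars P); first exact: prime_varsP (prime_proper hP).
apply: F0_min.2 => g Gg; apply: (prime_vars_meets hP).
apply: (prime_exp (m := s) hP); rewrite mpolyXn; apply: sP.
by apply/monomial_idealX; apply: mnm_exp_muln.
Qed.

Lemma squarefree_dim : has_quot_dim I (n - #|F0|).
Proof.
have -> : I = ideal_exp I 1; last exact: exp_dim.
rewrite ideal_exp_monomial; apply/seteqP; split; apply: monomial_idealS => m.
  by move=> Bm; exists m, 0%MM; rewrite addm0.
by move=> [b [c [Bb _ ->]]]; apply: mnm_above_up Bb; apply: lem_addr.
Qed.

Lemma min_cover_assoc F : is_min_cover G F -> is_assoc_prime I (var_ideal F).
Proof.
move=> mF; split; first exact: var_ideal_prime.
(* The witness is the product of the variables outside [F]. It is not in [var_ideal F], while its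
   product with any [x_i], [i] in [F], is divisible by the squarefree generator that meets [F] only
   at [i]. *)
exists 'X_[[multinom (i \notin F : nat) | i < n]].
apply/seteqP; split=> [f Ff m|f If].
  rewrite (perm_mem (msuppMX _ _)) => /mapP[m' /Ff /meetsP[i iF m'i] ->].
  have [g Gg gF] := min_cover_private mF iF.
  exists g => //; apply/mnm_lepP => j; rewrite mnmDE mnmE.
  have := G_squarefree Gg j; have [jF|_] := boolP (j \in F); last by lia.
  have [->|ji] := eqVneq j i; first by move: m'i; lia.
  by rewrite gF.
have : var_ideal F (f * 'X_[[multinom (i \notin F : nat) | i < n]]).
  by move: If; apply: monomial_idealS => m [g /mF.1 Fg gm]; apply: meets_up Fg.
case/prime_idealP: (var_ideal_prime k F) => _ h /h[] // /monomial_idealX.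
by move=> /meetsP[i iF]; rewrite mnmE iF.
Qed.

(** An associated prime contains the ideal, so its variables form a cover; the dimension forces this
    cover to have least size, and then the prime is generated by these variables. *)
Lemma top_assoc_primes :
  [set P | is_assoc_prime I P /\ has_quot_dim P (n - #|F0|)] =
  @var_ideal k n @` [set F | is_cover G F /\ #|F| = #|F0|].
Proof.
apply/seteqP; split=> [P [[hP [f PE]] dimP]|_ [F [cF FE] <-]]; last first.
  split; last by rewrite -FE; apply: var_ideal_dim.
  by apply: min_cover_assoc; split=> // F'; rewrite FE; apply: F0_min.2.
have cP : is_cover G (prime_vars P).
  move=> g Gg; apply: prime_vars_meets hP _; rewrite PE /ann_class /= mulrC.
  apply: monomial_idealM; first exact: mnm_above_up.
  by apply/monomial_idealX; exists g => //; apply: lepm_refl.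
have FP := prime_varsP (prime_proper hP).
have dle : (n - #|F0| <= n - #|prime_vars P|)%N.
  move/quot_dimP: dimP => [_ [p [hp P0]] _].
  exact: chain_above_var_ideal (conj hp (subset_trans FP P0)).
have cle := F0_min.2 _ cP.
have cE : #|prime_vars P| = #|F0|.
  have : (#|prime_vars P| <= n)%N by rewrite -[leqRHS](card_ord n) max_card.
  have : (#|F0| <= n)%N by rewrite -[leqRHS](card_ord n) max_card.
  lia.
exists (prime_vars P) => //; apply/esym/prime_dim_var_ideal => //.
by rewrite cE.
Qed.

Lemma top_assoc_primes_card mu :
  [set P | is_assoc_prime I P /\ has_quot_dim P (n - #|F0|)] #= `I_mu ->
  mu = #|[set F : {set 'I_n} | `[< is_cover G F >] & #|F| == #|F0| ]%SET|.
Proof.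
rewrite top_assoc_primes => hmu; set A := [set F | _ & _]%SET.
have inj : injective (@var_ideal k n).
  move=> F F' E; apply/eqP; rewrite finset.eqEsubset.
  by apply/andP; split; apply/(var_ideal_subset k); rewrite E.
have AE : [set F | is_cover G F /\ #|F| = #|F0|] = [set` A].
  apply/seteqP; split=> F /=; rewrite inE.
    by move=> [/asboolP -> ->]; rewrite eqxx.
  by move=> /andP[/asboolP ? /eqP].
move: hmu; rewrite AE (card_eql (inj_card_eq (in2W inj))).
have -> : [set` A] = @enum_val _ (mem A) @` [set: 'I_#|A|].
  apply/seteqP; split=> [F /= FA|_ [j _ <-] /=]; last exact: enum_valP.
  by exists (enum_rank_in FA F) => //; rewrite enum_rankK_in.
rewrite (card_eql (inj_card_eq (in2W (@enum_val_inj _ (mem A))))).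
by rewrite -(card_eql card_II) => /card_eq_II.
Qed.

End SquarefreeIdeal.
(** * Hilbert series *)

Section HilbertFunction.
Variables (k : fieldType) (n : nat).
Local Notation S := {mpoly k[n]}.
Variable B : 'X_{1..n} -> Prop.

(** The bounded multinomials, of degree at most [j], provide a finite type to count in. *)
Definition standard_mnms j : {set 'X_{1..n < j.+1}} :=
  [set m : 'X_{1..n < j.+1} | (mdeg m == j) && ~~ `[< B m >]]%SET.

Definition standard_mnm j (i : 'I_#|standard_mnms j|) : 'X_{1..n} :=
  (enum_val i : 'X_{1..n < j.+1}).

Lemma standard_mnm_inj j : injective (@standard_mnm j).
Proof. by move=> i i' /val_inj /enum_val_inj. Qed.

Lemma standard_mnmP j i :
  mdeg (@standard_mnm j i) = j /\ ~ B (@standard_mnm j i).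
Proof. by have := enum_valP i; rewrite inE => /andP[/eqP ? /asboolPn]. Qed.

Lemma mcoeff_standard_sum j (c : 'I_#|standard_mnms j| -> k) i :
  (\sum_i c i *: 'X_[standard_mnm i] : S)@_(standard_mnm i) = c i.
Proof.
rewrite raddf_sum (bigD1 i) //= mcoeffZ mcoeffX eqxx mulr1.
rewrite big1 ?addr0 // => l li.
by rewrite mcoeffZ mcoeffX (inj_eq (@standard_mnm_inj j)) (negPf li) mulr0.
Qed.

Lemma hilbert_function_standard :
  is_hilbert_function (monomial_ideal B : set S) (fun j => #|standard_mnms j|).
Proof.
move=> j; exists (fun i => 'X_[@standard_mnm j i]); split=> [i|v vj|c Bc i].
- by have [mi _] := standard_mnmP i; rewrite /= dhomogX /= mi.
- exists (fun i => v@_(standard_mnm i)) => m; apply: contraPP => nB.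
  rewrite mcoeff_msupp; apply/negP; rewrite negbK mcoeffB subr_eq0; apply/eqP.
  have [mj|mj] := eqVneq (mdeg m) j; last first.
    rewrite (dhomog_nemf_coeff vj mj) raddf_sum big1 //= => i _.
    rewrite mcoeffZ mcoeffX; case: eqP => [E|_]; last by rewrite mulr0.
    by case: (standard_mnmP i); rewrite E => E'; rewrite E' eqxx in mj.
  have lt : (mdeg m < j.+1)%N by rewrite mj.
  have mA : BMultinom lt \in standard_mnms j.
    by rewrite inE /= mj eqxx; apply/asboolPn.
  have mE : m = standard_mnm (enum_rank_in mA (BMultinom lt)).
    by rewrite /standard_mnm enum_rankK_in.
  by rewrite {2}mE mcoeff_standard_sum -mE.
apply: contrapT => /eqP ci; apply: (standard_mnmP i).2; apply: Bc.
by rewrite mcoeff_msupp mcoeff_standard_sum.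
Qed.

Definition mnm_of_ffun N (f : {ffun 'I_n -> 'I_N}) : 'X_{1..n} :=
  [multinom (f i : nat) | i < n].

Lemma card_standard_box N j : (j <= N)%N ->
  #|standard_mnms j| =
  #|[set f : {ffun 'I_n -> 'I_N.+1} |
      (\sum_i f i == j)%N && ~~ `[< B (mnm_of_ffun f) >]]%SET|.
Proof.
move=> jN; pose h (m : 'X_{1..n < j.+1}) := [ffun i => inord (m i) : 'I_N.+1].
have mN (m : 'X_{1..n < j.+1}) i : (m i < N.+1)%N.
  rewrite ltnS (leq_trans _ jN) // -ltnS (leq_ltn_trans _ (bmdeg m)) //.
  by rewrite mdegE (bigD1 i) //= leq_addr.
have hK m : mnm_of_ffun (h m) = m.
  by apply/mnmP => i; rewrite mnmE ffunE inordK.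
have h_inj : injective h.
  by move=> m m' E; apply: val_inj; rewrite /= -hK E hK.
rewrite -(card_imset _ h_inj); apply: eq_card => f; rewrite inE.
apply/imsetP/idP => [[m mA ->]|/andP[/eqP fj nB]].
  move: mA; rewrite inE hK mdegE => /andP[/eqP mj ->]; rewrite andbT.
  by apply/eqP; rewrite -[RHS]mj; apply: eq_bigr => i _; rewrite ffunE inordK.
have fdeg : mdeg (mnm_of_ffun f) = j.
  by rewrite mdegE -fj; apply: eq_bigr => i _; rewrite mnmE.
have lt : (mdeg (mnm_of_ffun f) < j.+1)%N by rewrite fdeg.
exists (BMultinom lt); first by rewrite inE /= fdeg eqxx.
by apply/ffunP => i; rewrite ffunE /= mnmE inord_val.
Qed.

(** A polynomial stand-in for the Hilbert series: correct up to degree [N], while beyond it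
    monomials with an entry above [N] are missing. *)
Definition box_series N : {poly int} :=
  \sum_(f : {ffun 'I_n -> 'I_N.+1} | ~~ `[< B (mnm_of_ffun f) >])
    'X^(\sum_i f i).

Lemma coef_box_series N j : (j <= N)%N ->
  (box_series N)`_j = #|standard_mnms j|%:Z.
Proof.
move=> jN; rewrite (card_standard_box jN) coef_sum -[RHS]natz -sumr_const.
rewrite big_mkcond [RHS]big_mkcond /=; apply: eq_bigr => f _.
by rewrite inE coefXn eq_sym andbC; case: ifP => //=; case: eqP.
Qed.

End HilbertFunction.

(** * Congruence modulo a power of ['X], and the decomposition into truncated cones *)

Definition eq_upto (N : nat) (p q : {poly int}) : Prop :=
  forall j, (j <= N)%N -> p`_j = q`_j.

Lemma eq_uptoM N p p' q q' :
  eq_upto N p p' -> eq_upto N q q' -> eq_upto N (p * q) (p' * q').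
Proof.
move=> pp qq j jN; rewrite !coefM; apply: eq_bigr => i _.
by rewrite pp ?qq // ?(leq_trans (leq_subr _ _)) // (leq_trans _ jN) // -ltnS.
Qed.

Lemma eq_upto_sum N (T : finType) (A : pred T) (p q : T -> {poly int}) :
  (forall i, A i -> eq_upto N (p i) (q i)) ->
  eq_upto N (\sum_(i | A i) p i) (\sum_(i | A i) q i).
Proof. by move=> h j jN; rewrite !coef_sum; apply: eq_bigr => i /h ->. Qed.

Lemma eq_upto_prod N (T : finType) (p q : T -> {poly int}) :
  (forall i, eq_upto N (p i) (q i)) -> eq_upto N (\prod_i p i) (\prod_i q i).
Proof.
by move=> h; elim/big_ind2: _ => // p1 p2 q1 q2; apply: eq_uptoM.
Qed.

Section TruncatedCones.
Variables (n s : nat) (B : 'X_{1..n} -> Prop).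
Local Notation box := {ffun 'I_n -> 'I_s.+1}.
Hypothesis B_min : forall m : 'X_{1..n},
  B [multinom minn (m i) s | i < n] <-> B m.

Definition cone_vars (v : box) : {set 'I_n} := [set i | v i == ord_max]%SET.

(** The sum of the cone series brought to the common denominator [(1 - t)^D]; the subtraction on
    [nat] is faithful when no cone has dimension above [D]. *)
Definition hilbert_numerator (D : nat) : {poly int} :=
  \sum_(v : box | ~~ `[< B (mnm_of_ffun v) >])
    (1 - 'X) ^+ (D - #|cone_vars v|) * 'X^(\sum_i v i).

(** The factor of a cone in one variable: below [s] only the exponent [e] truncates to [e], while
    for [e = s] all exponents from [s] on do, and [1 - 'X] collapses that geometric series. *)
Lemma truncated_line N (e : 'I_s.+1) : (s <= N)%N ->
  eq_upto N ((if e == ord_max then 1 - 'X else 1) *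
             \sum_(j < N.+1 | minn j s == e) 'X^j) 'X^e.
Proof.
move=> sN j jN; set q := bigop _ _ _.
have qE i : (i <= N)%N -> q`_i = (minn i s == e)%:R.
  move=> iN; rewrite coef_sum big_mkcond.
  rewrite (bigD1 (Ordinal (iN : i < N.+1)%N)) //=.
  rewrite big1 ?addr0 => [|l li]; first by rewrite coefXn eqxx; case: ifP.
  rewrite coefXn; case: ifP => // _; case: eqP => // il.
  by case/eqP: li; apply: val_inj; rewrite /= il.
have es := ltn_ord e; have emax : (e == ord_max) = (e == s :> nat) by [].
rewrite coefXn emax; case: eqP => [E|E]; last first.
  by rewrite mul1r qE //; congr (_%:R); apply/eqP; case: eqP; case: eqP; lia.
rewrite mulrBl mul1r coefB coefXM qE //; case: (j =P 0%N) => [j0|j0].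
  by rewrite subr0; congr (_%:R); apply/eqP; case: eqP; case: eqP; lia.
rewrite qE; last by lia.
by case: eqP; case: eqP; case: eqP; rewrite ?subrr ?subr0 //; lia.
Qed.

Definition truncate N (f : {ffun 'I_n -> 'I_N.+1}) : box :=
  [ffun i => inord (minn (f i) s)].

(** Monomials are grouped by their truncation, which [B] respects by [B_min]; each group is cut out
    by one condition per variable, so its sum factors. *)
Lemma box_series_cones N : box_series B N =
  \sum_(v : box | ~~ `[< B (mnm_of_ffun v) >])
    \prod_i \sum_(j < N.+1 | minn j s == v i) 'X^j.
Proof.
have trE (f : {ffun 'I_n -> 'I_N.+1}) i : truncate f i = minn (f i) s :> nat.
  by rewrite ffunE inordK // ltnS geq_minr.
have trB (f : {ffun 'I_n -> 'I_N.+1}) :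
    `[< B (mnm_of_ffun (truncate f)) >] = `[< B (mnm_of_ffun f) >].
  apply: asbool_equiv_eq.
  have -> : mnm_of_ffun (truncate f) =
      [multinom minn (mnm_of_ffun f i) s | i < n].
    by apply/mnmP => i; rewrite !mnmE trE.
  exact: B_min.
rewrite /box_series (partition_big (@truncate N)
  (fun v => ~~ `[< B (mnm_of_ffun v) >])) /= => [|f]; last by rewrite trB.
apply: eq_bigr => v nBv; rewrite bigA_distr_big_dep.
apply: eq_big => [f|f _]; last by rewrite expr_sum.
rewrite -trB; apply/andP/familyP => [[_ /eqP <-] i|fv].
  by rewrite unfold_in /= trE.
have -> : truncate f = v; last by rewrite nBv.
by apply/ffunP => i; apply: val_inj; rewrite /= trE; apply/eqP; apply: fv.
Qed.

Lemma hilbert_numerator_cones (D : nat) :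
  (forall v : box, ~ B (mnm_of_ffun v) -> (#|cone_vars v| <= D)%N) ->
  is_hilbert_numerator (fun j => #|standard_mnms B j|) D (hilbert_numerator D).
Proof.
(* [N] must reach [a], the degree compared, and [s], as [truncated_line] requires. *)
move=> leD a; pose N := (a + s)%N.
transitivity (((1 - 'X : {poly int}) ^+ D * box_series B N)`_a).
  rewrite coefM; apply: eq_bigr => i _; rewrite coef_box_series //.
  by rewrite (leq_trans (leq_subr _ _)) // leq_addr.
rewrite box_series_cones mulr_sumr.
apply: (@eq_upto_sum N); last exact: leq_addr.
move=> v /asboolPn /leD vD.
(* One factor [1 - 'X] is spent on each cone variable; the others stay in the numerator. *)
rewrite -{1}(subnK vD) exprD -mulrA; apply: eq_uptoM => //.
have -> : (1 - 'X : {poly int}) ^+ #|cone_vars v| =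
    \prod_i (if v i == ord_max then 1 - 'X else 1).
  rewrite -big_mkcond /= -prodr_const; apply: eq_bigl => i.
  by rewrite inE.
rewrite -big_split expr_sum; apply: eq_upto_prod => i.
by apply: truncated_line; rewrite leq_addl.
Qed.

(** Cones of dimension below [D] keep a factor [1 - 'X] and vanish at 1; the others contribute 1
    each. *)
Lemma hilbert_numerator_at1 (D : nat) :
  (forall v : box, ~ B (mnm_of_ffun v) -> (#|cone_vars v| <= D)%N) ->
  (hilbert_numerator D).[1] =
  #|[set v : box | ~~ `[< B (mnm_of_ffun v) >] & #|cone_vars v| == D]%SET|%:Z.
Proof.
move=> leD; rewrite horner_sum -[RHS]natz -sumr_const.
rewrite big_mkcond [RHS]big_mkcond /=; apply: eq_bigr => v _; rewrite inE.
case: ifP => //= /asboolPn /leD; rewrite leq_eqVlt => vD.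
rewrite hornerM !horner_exp !hornerE subrr expr1n mulr1.
case/predU1P: vD => [->|vD]; rewrite ?subnn ?eqxx //.
by rewrite expr0n subn_eq0 leqNgt vD ltn_eqF.
Qed.

End TruncatedCones.

(** * Counting vectors of bounded degree *)

Section CountCones.
Variables (n s : nat).
Local Notation box := {ffun 'I_n -> 'I_s.+1}.

Lemma card_bounded_box (F : {set 'I_n}) : (0 < s)%N ->
  #|[set v : box | [forall (i | i \notin F), v i == ord_max] &&
                   (\sum_(i in F) v i < s)%N]%SET| = 'C(#|F| + s - 1, s - 1).
Proof.
case: s => // s' _; rewrite addnS !subn1 /= -bin_sub ?leq_addl // addnK.
rewrite -card_partial_ord_partitions.
(* [h] spreads a tuple along [enum F] and puts the maximal value [s'.+1] elsewhere. Tuple entries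
   stop at [s'] because a sum below [s'.+1] bounds each of its terms. *)
pose h (t : #|F|.-tuple 'I_s'.+1) : {ffun 'I_n -> 'I_s'.+2} :=
  [ffun i => inord (if i \in F
    then nat_of_ord (nth ord0 t (index i (enum F))) else s'.+1)].
have hF t (j : 'I_#|F|) : h t (enum_val j) = tnth t j :> nat.
  have jE : index (enum_val j) (enum F) = j.
    rewrite (enum_val_nth (enum_val j)) index_uniq ?enum_uniq //.
    by rewrite -cardE ltn_ord.
  by rewrite ffunE (enum_valP j) jE -tnth_nth inordK // ltnS ltnW.
have hN t i : i \notin F -> h t i = ord_max.
  by move=> iF; apply: val_inj; rewrite ffunE (negPf iF) /= inordK.
have h_sum t : (\sum_(i in F) h t i = \sum_(j <- t) j)%N.
  by rewrite big_enum_val big_tuple; apply: eq_bigr => j _; rewrite hF.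
have h_inj : injective h.
  move=> t t' E; apply: eq_from_tnth => j; apply: val_inj.
  by rewrite /= -!hF E.
rewrite -(card_imset _ h_inj); apply: eq_card => v; rewrite inE.
apply/andP/imsetP => [[/forall_inP vN vF]|[t]]; last first.
  rewrite inE => tS ->; rewrite h_sum ltnS tS; split=> //.
  by apply/forall_inP => i /hN ->.
have vlt i : i \in F -> (v i < s'.+1)%N.
  by move=> iF; apply: leq_ltn_trans vF; rewrite (bigD1 i) //= leq_addr.
pose t := [tuple inord (v (enum_val j)) : 'I_s'.+1 | j < #|F|].
have vE : v = h t.
  apply/ffunP => i; have [iF|iF] := boolP (i \in F); last first.
    by rewrite hN //; apply/eqP; apply: vN.
  apply: val_inj; rewrite /= -(enum_rankK_in iF iF) hF tnth_mktuple.
  by rewrite inordK // vlt // enum_rankK_in.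
by exists t => //; rewrite inE -h_sum -vE.
Qed.

End CountCones.

(** * The cones outside a power of the ideal *)

Section SquarefreeCones.
Variables (n s : nat) (G : set 'X_{1..n}) (F0 : {set 'I_n}).
Local Notation box := {ffun 'I_n -> 'I_s.+1}.
Local Notation B := (mnm_exp (mnm_above G) s).
Hypothesis G_squarefree : forall g, G g -> squarefree_mnm g.
Hypothesis F0_min : is_min_cover G F0.

Lemma mnm_exp_minE (m : 'X_{1..n}) : B [multinom minn (m i) s | i < n] <-> B m.
Proof.
split; last exact: mnm_exp_min.
by apply: mnm_exp_up; apply/mnm_lepP => i; rewrite mnmE geq_minl.
Qed.

(** A generator missed by the complement lives on variables where [v] equals [s], so its [s]-th
    power divides [v], which then lies in [B]. *)
Lemma cone_cover (v : box) : ~ B (mnm_of_ffun v) -> is_cover G (~: cone_vars v).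
Proof.
move=> nB g Gg; apply: contra_notT nB => nm.
apply: mnm_exp_up (mnm_exp_muln s Gg); apply/mnm_lepP => i; rewrite mulmnE mnmE.
have [iv|iv] := boolP (i \in cone_vars v).
  have -> : v i = ord_max by apply/eqP; rewrite inE in iv.
  by have := G_squarefree Gg i; rewrite /=; nia.
have -> : g i = 0%N by apply/eqP; apply: contraNT nm => gi; apply/meetsP;
  exists i; rewrite // finset.inE.
by rewrite mul0n.
Qed.

Lemma card_cone_vars (v : box) :
  ~ B (mnm_of_ffun v) -> (#|cone_vars v| <= n - #|F0|)%N.
Proof.
move=> /cone_cover /F0_min.2; have := cardsC (cone_vars v).
by rewrite card_ord; lia.
Qed.

(** For [v] maximal outside [F], [cover_exp_degree] and [min_cover_exp] together say that [v] avoids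
    [B] exactly when its degree in [F] is below [s]. *)
Lemma card_min_cover_cones (F : {set 'I_n}) : (0 < s)%N -> is_min_cover G F ->
  #|[set v : box | ~~ `[< B (mnm_of_ffun v) >] & ~: cone_vars v == F]%SET| =
  'C(#|F| + s - 1, s - 1).
Proof.
move=> s0 mF; rewrite -(card_bounded_box F s0).
apply: eq_card => v; rewrite !inE.
have sumE : (\sum_(i in F) mnm_of_ffun v i = \sum_(i in F) v i)%N.
  by apply: eq_bigr => i _; rewrite mnmE.
apply/andP/andP => [[/asboolPn nB /eqP vF]|[/forall_inP vN vF]].
  have vN i : i \notin F -> v i == ord_max by rewrite -vF !inE negbK.
  split; first exact/forall_inP.
  rewrite ltnNge; apply/negP => sF; apply: nB.
  apply: (min_cover_exp _ mF) => //.
    by move=> i /vN /eqP vi; rewrite mnmE vi.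
  by rewrite sumE.
(* The degree bound also keeps each entry on [F] below [s], so no index of [F] is a cone
   variable. *)
split; last first.
  apply/eqP/finset.setP => i; rewrite !inE.
  have [iF|/vN /eqP ->] := boolP (i \in F); last by rewrite eqxx.
  rewrite neq_ltn; apply/orP; left.
  by apply: leq_ltn_trans vF; rewrite (bigD1 i) //= leq_addr.
by apply/asboolPn => /(cover_exp_degree mF.1); rewrite sumE leqNgt vF.
Qed.

(** Cones are sorted by the complement of [cone_vars], a cover of least size, and every such cover
    has the same number of cones. *)
Lemma card_top_cones : (0 < s)%N ->
  #|[set v : box | ~~ `[< B (mnm_of_ffun v) >] &
                   #|cone_vars v| == (n - #|F0|)%N]%SET| =
  (#|[set F : {set 'I_n} | `[< is_cover G F >] & #|F| == #|F0| ]%SET| *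
   'C(#|F0| + s - 1, s - 1))%N.
Proof.
move=> s0; set A := [set F : {set _} | _ & _]%SET.
have cF0 : (#|F0| <= n)%N by rewrite -[leqRHS](card_ord n) max_card.
have cvE (v : box) : (#|~: cone_vars v| = n - #|cone_vars v|)%N.
  by have := cardsC (cone_vars v); rewrite card_ord; lia.
have cv (v : box) : (#|cone_vars v| <= n)%N.
  by rewrite -[leqRHS](card_ord n) max_card.
rewrite -sum1_card (partition_big (fun v => ~: cone_vars v) (mem A)) /=;
  last first.
  move=> v; rewrite !inE => /andP[/asboolPn /cone_cover cov /eqP card].
  by apply/andP; split; [apply/asboolP|rewrite cvE card subKn].
rewrite -sum_nat_const; apply: eq_bigr => F; rewrite inE.
move=> /andP[/asboolP cov /eqP cardF].
have mF : is_min_cover G F by split=> // F'; rewrite cardF; apply: F0_min.2.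
rewrite -cardF -(card_min_cover_cones s0 mF) -[RHS]sum1_card.
apply: eq_bigl => v.
rewrite !inE; have [vF|] := eqVneq (~: cone_vars v) F; last by rewrite !andbF.
have -> : #|cone_vars v| = (n - #|F|)%N.
  by have := cvE v; rewrite vF; have := cv v; lia.
by rewrite eqxx !andbT.
Qed.

End SquarefreeCones.

(** * The multiplicity formula *)

Theorem theorem1p1 (k : fieldType) (n : nat) (I : set {mpoly k[n]})
    (d mu : nat)
    (hI : is_squarefree_monomial_ideal I)
    (hI_nonzero : I <> [set 0])
    (hI_proper : I <> setT)
    (hd : has_quot_dim I d)
    (hmu : [set P | is_assoc_prime I P /\ has_quot_dim P d] #= `I_mu) :
  forall s : nat, (1 <= s)%N ->
    has_multiplicity (ideal_exp I s) (mu * 'C(n - d + s - 1, s - 1))%N%:Z.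
Proof.
move=> s s0; case: hI => G [Gsq IE]; rewrite ideal_gen_above in IE.
have nG0 : ~ G 0%MM.
  move=> G0; apply: hI_proper; apply/seteqP; split=> // f _; rewrite IE => m _.
  by exists 0%MM => //; apply/mnm_lepP => i; rewrite mnm0E.
have [F0 mF0] := min_cover_exists nG0.
have dE : d = (n - #|F0|)%N.
  by apply: quot_dim_unique hd _; rewrite IE; apply: squarefree_dim.
have F0n : (#|F0| <= n)%N by rewrite -[leqRHS](card_ord n) max_card.
rewrite {}dE {}IE in hmu *.
rewrite (top_assoc_primes_card Gsq mF0 hmu) subKn //.
set B := mnm_exp (mnm_above G) s.
have Q1 := hilbert_numerator_at1 (card_cone_vars Gsq mF0 (s := s)).
rewrite (card_top_cones Gsq mF0 s0) in Q1.
exists (n - #|F0|)%N, (fun j => #|standard_mnms B j|),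
  (hilbert_numerator s B (n - #|F0|)); split=> //.
- exact: exp_dim.
- by rewrite ideal_exp_monomial; apply: hilbert_function_standard.
- apply: hilbert_numerator_cones; first exact: mnm_exp_minE.
  exact: card_cone_vars.
(* The value at 1 is positive because [F0] itself is among the covers counted. *)
rewrite Q1 ltz_nat muln_gt0 bin_gt0; apply/andP; split; last by lia.
apply/card_gt0P; exists F0; rewrite inE eqxx andbT; apply/asboolP; exact: mF0.1.
Qed.
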